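(* For $n\ge 0$ and $k\ge 0$, the number $u_{n,k}$ of tilings of the honeycomb strip $H_n$ by monomers, slanted dimers and trimers using exactly $k$ dimers is $$u_{n,k}=\sum_{\substack{i_0,\dots,i_k\ge 0\\ i_0+\cdots+i_k=n-2k}}N_{i_0}N_{i_1}\cdots N_{i_k},$$ where $N_j$ is Narayana's cows sequence: $N_0=N_1=N_2=1$ and $N_j=N_{j-1}+N_{j-3}$ for $j\ge3$.
   Context: The honeycomb strip $H_n$ consists of $n$ regular hexagons numbered $1,\dots,n$ arranged in two rows (odd-numbered on the bottom, even-numbered on top), hexagon $i$ sharing an edge with hexagons $i\pm1$ and $i\pm2$. The allowed tiles are: monomers $\{i\}$, slanted dimers $\{i,i+1\}$, and trimers $\{i,i+1,i+2\}$ (horizontal dimers $\{i,i+2\}$ are not allowed); a tiling is a partition of the hexagons of $H_n$ into such tiles, and $H_0$ has one (empty) tiling. An empty sum (when $n-2k<0$) is $0$. *)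

(* Defs.v *)
From mathcomp Require Import all_boot.

Set Implicit Arguments.
Unset Strict Implicit.
Unset Printing Implicit Defensive.

(* The hexagons 1, ..., n of the strip H_n are encoded by 'I_n, hexagon i
   being the ordinal of value i - 1. *)

Section Tiles.

Variable n : nat.
Implicit Types (t : {set 'I_n}) (P : {set {set 'I_n}}).

Definition monomer t : bool := [exists i : 'I_n, t == [set i]].

(* Slanted dimers only: {i, i+2} is excluded. *)
Definition dimer t : bool :=
  [exists i : 'I_n, exists j : 'I_n, (j == i.+1 :> nat) && (t == [set i; j])].

Definition trimer t : bool :=
  [exists i : 'I_n, exists j : 'I_n, exists l : 'I_n,
    [&& j == i.+1 :> nat, l == i.+2 :> nat & t == [set i; j; l]]].

Definition tile t : bool := [|| monomer t, dimer t | trimer t].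

Definition tiling P : bool :=
  partition P [set: 'I_n] && [forall t in P, tile t].

End Tiles.

Definition num_tilings (n k : nat) : nat :=
  #|[set P : {set {set 'I_n}} | tiling P & #|[set t in P | dimer t]| == k]|.

(* Narayana's cows sequence *)
Fixpoint narayana (j : nat) : nat :=
  match j with
  | ((m.+1).+1 as p).+1 => narayana p + narayana m
  | _ => 1
  end.

(* Main.v *)
Require Import Defs.
From mathcomp Require Import all_boot.
From mathcomp Require Import ssralg poly zify.

(** Both sides satisfy the same recurrence.  Removing the tile that contains
    the last hexagon of the initial segment of length [m + 1] leaves an
    initial segment of length [m], [m - 1] or [m - 2], according to the size
    of the tile.  On the other side, the sum is the coefficient of [X^n] in
    [A^(k+1) X^(2k)] with [A = \sum_j N_j X^j], and [A = 1 + X A + X^3 A]. *)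

Set Implicit Arguments.
Unset Strict Implicit.
Unset Printing Implicit Defensive.

Import GRing.Theory.

(** * Tilings of an arbitrary region of the strip *)

Section Tilings.

Variable n : nat.
Implicit Types (t D : {set 'I_n}) (P Q : {set {set 'I_n}}) (K : pred nat).

Definition tiling_of D P : bool := partition P D && [forall t in P, tile t].

Definition num_dimers P : nat := #|[set t in P | dimer t]|.

(** The region [D] varies because removing a tile leaves a smaller region of the same strip. Using a
    predicate [K] instead of an exact number of dimers lets the removal of a dimer be a shift of
    [K], without truncated subtraction. *)
Definition num_tilings_of D K : nat :=
  #|[set P | tiling_of D P & K (num_dimers P)]|.

Lemma num_dimersU1 t P :
  t \notin P -> num_dimers (t |: P) = num_dimers P + dimer t.
Proof.
move=> tP; rewrite /num_dimers; case Ht: (dimer t).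
  have -> : [set s in t |: P | dimer s] = t |: [set s in P | dimer s].
    by apply/setP=> s; rewrite !inE; case: eqP => [->|//]; rewrite Ht.
  by rewrite cardsU1 inE (negPf tP) addnC.
rewrite addn0; congr #|pred_of_set _|; apply/setP=> s; rewrite !inE.
by case: eqP => [->|//]; rewrite Ht !andbF.
Qed.

Lemma eq_num_tilings_of D K1 K2 :
  K1 =1 K2 -> num_tilings_of D K1 = num_tilings_of D K2.
Proof.
by move=> eqK; congr #|pred_of_set _|; apply/setP=> P; rewrite !inE eqK.
Qed.

Lemma num_tilings_of_pred0 D : num_tilings_of D xpred0 = 0.
Proof. by apply: eq_card0 => P; rewrite !inE andbF. Qed.

Lemma num_tilings_of_set0 K : num_tilings_of set0 K = K 0.
Proof.
have d0 : num_dimers set0 = 0 by apply: eq_card0 => t; rewrite !inE.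
rewrite /num_tilings_of; case K0: (K 0).
  rewrite -[RHS](cards1 (set0 : {set {set 'I_n}})); congr #|pred_of_set _|.
  apply/setP=> P; rewrite !inE /tiling_of partition_set0.
  case: eqP => [->|//]; rewrite d0 K0 andbT.
  by apply/forall_inP => t; rewrite inE.
apply: eq_card0 => P; rewrite !inE /tiling_of partition_set0.
by case: eqP => [->|//]; rewrite d0 K0 andbF.
Qed.

(** Tilings are sorted by the tile [t] covering [x]; adjoining [t] is a bijection from the tilings
    of [D :\: t] onto those in which [t] covers [x]. *)
Lemma num_tilings_of_rec D (x : 'I_n) K : x \in D ->
  num_tilings_of D K =
  \sum_(t | [&& tile t, x \in t & t \subset D])
     num_tilings_of (D :\: t) (fun j => K (j + dimer t)).
Proof.
move=> xD; rewrite /num_tilings_of -sum1_card.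
rewrite (partition_big (fun P => pblock P x)
           (fun t => [&& tile t, x \in t & t \subset D])) /=; last first.
  move=> P; rewrite inE => /andP[/andP[Ppart /forall_inP Ptile] _].
  have xP : x \in cover P by rewrite (cover_partition Ppart).
  by rewrite Ptile ?pblock_mem // mem_pblock xP (partitionS Ppart) ?pblock_mem.
apply: eq_bigr => t /and3P[tt xt tD]; rewrite sum1dep_card.
have tN Q : partition Q (D :\: t) -> t \notin Q.
  move=> Qpart; apply/negP => tQ.
  by have /subsetP/(_ x xt) := partitionS Qpart tQ; rewrite inE xt.
rewrite -[RHS](card_in_imset (f := fun Q => t |: Q)); last first.
  move=> Q1 Q2; rewrite !inE => /andP[/andP[p1 _] _] /andP[/andP[p2 _] _] eqQ.
  by rewrite -(setU1K (tN _ p1)) -(setU1K (tN _ p2)) eqQ.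
congr #|pred_of_set _|; apply/setP=> P; rewrite inE.
apply/idP/imsetP => [|[Q]].
  rewrite inE => /andP[/andP[/andP[Ppart /forall_inP Ptile] KP] /eqP Pt].
  have tP : t \in P by rewrite -Pt pblock_mem // (cover_partition Ppart).
  exists (P :\ t); last by rewrite setD1K.
  rewrite inE /tiling_of partitionD1 //=; apply/andP; split.
    by apply/forall_inP => s; rewrite inE => /andP[_ /Ptile].
  by rewrite -num_dimersU1 ?setD1K // !inE eqxx.
rewrite inE => /andP[/andP[Qpart /forall_inP Qtile] KQ] ->.
have Upart : partition (t |: Q) D.
  rewrite -(setID D t) (setIidPr tD); apply: partitionU1 => //.
    by apply/set0Pn; exists x.
  by rewrite -setI_eq0 setIDA setIC -setIDA setDv setI0.
rewrite inE num_dimersU1 ?tN // KQ andbT /tiling_of Upart /=.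
rewrite (def_pblock (partition_trivIset Upart) _ xt) ?eqxx ?setU11 // andbT.
by apply/forall_inP => s; rewrite !inE => /orP[/eqP->|/Qtile].
Qed.

(** * Tiles as segments of consecutive hexagons *)

Definition segment (a b : nat) : {set 'I_n} := [set i : 'I_n | a <= i < b].

Lemma monomer_segment (i : 'I_n) : [set i] = segment i i.+1.
Proof. by apply/setP=> x; rewrite !inE -val_eqE /=; lia. Qed.

Lemma dimer_segment (i j : 'I_n) :
  j = i.+1 :> nat -> [set i; j] = segment i i.+2.
Proof. by move=> ji; apply/setP=> x; rewrite !inE -!val_eqE /= ji; lia. Qed.

Lemma trimer_segment (i j l : 'I_n) : j = i.+1 :> nat -> l = i.+2 :> nat ->
  [set i; j; l] = segment i i.+3.
Proof.
by move=> ji li; apply/setP=> x; rewrite !inE -!val_eqE /= ji li; lia.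
Qed.

Lemma tileP t :
  reflect (exists a d, [/\ d < 3, a + d < n & t = segment a (a + d).+1])
          (tile t).
Proof.
apply: (iffP or3P) => [[]|[a [d [d3 adn ->]]]].
- case/existsP=> i /eqP ->; exists i, 0.
  by rewrite addn0; split => //; exact: monomer_segment.
- case/existsP=> i /existsP[j /andP[/eqP ji /eqP ->]]; exists i, 1.
  by rewrite addn1 -{1}ji; split => //; exact: dimer_segment.
- case/existsP=> i /existsP[j /existsP[l /and3P[/eqP ji /eqP li /eqP ->]]].
  exists i, 2.
  by rewrite addn2 -{1}li; split => //; exact: trimer_segment.
have an : a < n by lia.
case: d d3 adn => [|[|[|//]]] _ adn; rewrite ?addn0 ?addn1 ?addn2 in adn *.
- by constructor 1; apply/existsP; exists (Ordinal an); rewrite monomer_segment.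
- constructor 2; apply/existsP; exists (Ordinal an); apply/existsP.
  by exists (Ordinal adn); rewrite eqxx (dimer_segment (i := Ordinal an)) /=.
- have an1 : a.+1 < n by lia.
  constructor 3; apply/existsP; exists (Ordinal an); apply/existsP.
  exists (Ordinal an1); apply/existsP; exists (Ordinal adn).
  by rewrite !eqxx (trimer_segment (i := Ordinal an)) /=.
Qed.

Lemma segment_inj a b c : a < c -> b < c -> c <= n ->
  segment a c = segment b c -> a = b.
Proof.
move=> ac bc cn /setP eqs.
have an : a < n by lia.
have bn : b < n by lia.
by have := eqs (Ordinal an); have := eqs (Ordinal bn); rewrite !inE /=; lia.
Qed.

Lemma dimer_of_segment a d : a + d < n ->
  dimer (segment a (a + d).+1) = (d == 1).
Proof.
move=> adn; apply/existsP/eqP => [[i /existsP[j /andP[/eqP ji /eqP]]]|d1].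
  rewrite (dimer_segment ji) => /setP eqs.
  have an : a < n by lia.
  have := eqs i; have := eqs j; have := eqs (Ordinal an).
  by have := eqs (Ordinal adn); rewrite !inE /=; lia.
rewrite {}d1 addn1 in adn *.
have an : a < n by lia.
exists (Ordinal an); apply/existsP; exists (Ordinal adn).
by rewrite eqxx (dimer_segment (i := Ordinal an)) /=.
Qed.

(** A tile inside the initial segment that covers its last hexagon [m] must end there, so it is
    determined by its size [d + 1]; the condition [d <= m] says that it fits. *)
Lemma num_tilings_segmentS m K : m < n ->
  num_tilings_of (segment 0 m.+1) K =
  \sum_(d < 3 | d <= m)
     num_tilings_of (segment 0 (m - d)) (fun j => K (j + (d == 1 :> nat))).
Proof.
move=> mn; pose x := Ordinal mn.
rewrite (@num_tilings_of_rec _ x); last by rewrite inE /=.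
pose h (d : 'I_3) := segment (m - d) m.+1.
have hinj : {in [pred d : 'I_3 | d <= m] &, injective h}.
  move=> d e; rewrite !inE => dm em /segment_inj eqde.
  by apply/val_inj => /=; lia.
rewrite (eq_bigl (mem (h @: [pred d : 'I_3 | d <= m]))); last first.
  move=> t /=; apply/and3P/imsetP => [[/tileP[a [d [d3 adn ->]]]]|[d]].
    rewrite inE /= => xt /subsetP sub.
    have := sub (Ordinal adn); rewrite !inE /= => subd.
    have adm : a + d = m by lia.
    exists (Ordinal d3); rewrite ?inE /=; first lia.
    by rewrite /h /= -adm addnK.
  rewrite inE => dm ->; split; last 1 first.
  - by apply/subsetP => y; rewrite !inE; lia.
  - by apply/tileP; exists (m - d), d; rewrite subnK.
  - by rewrite inE /=; lia.
rewrite big_imset //=; apply: eq_big => [d|d]; rewrite inE // => dm.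
have -> : segment 0 m.+1 :\: h d = segment 0 (m - d).
  by apply/setP=> y; rewrite !inE; lia.
apply: eq_num_tilings_of => j; congr (K (j + nat_of_bool _)).
by rewrite /h -{2}(subnK dm) dimer_of_segment ?subnK.
Qed.

End Tilings.

(** * Generating function of Narayana's cows sequence *)

Lemma narayanaS j :
  narayana j.+1 = narayana j + (if j < 2 then 0 else narayana (j - 2)).
Proof. by case: j => [|[|j]] //=; rewrite !subSS subn0. Qed.

Section Cows.

Variable N : nat.

(** A polynomial truncation of the power series [A]: its functional equation is only claimed for
    coefficients of index at most [N]. *)
Definition cows : {poly nat} := (\poly_(i < N.+1) narayana i)%R.

(* [narayana j] counts the tilings of a gap of length j by monomers and trimers,
   and k dimers leave k + 1 gaps. *)
Definition cows_dimers k : {poly nat} := (cows ^+ k.+1 * 'X^(2 * k))%R.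

Lemma coef_cows_rec i : i <= N ->
  (cows`_i = (1 + 'X * cows + 'X^3 * cows)`_i)%R.
Proof.
move=> iN; rewrite !coefD coef1 coefXM coefXnM !coef_poly ltnS iN.
case: i iN => [|j] jN //; rewrite narayanaS /= add0r.
have -> : j < N.+1 by lia.
rewrite subSS; congr (_ + _)%R.
by have -> : j - 2 < N.+1 by lia.
Qed.

(** The coefficient of index [i] in a product involves only coefficients of index at most [i] of
    [cows], so the truncation does no harm. *)
Lemma coef_cowsM_rec (S : {poly nat}) i : i <= N ->
  ((cows * S)`_i = S`_i + ('X * (cows * S))`_i + ('X^3 * (cows * S))`_i)%R.
Proof.
move=> iN; rewrite -!coefD !mulrA -{2}[S]mul1r -!mulrDl !coefM.
by apply: eq_bigr => j _; rewrite coef_cows_rec //; case: j => /= j; lia.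
Qed.

Lemma num_tilings_coef n m k : m <= n -> m <= N ->
  num_tilings_of (segment n 0 m) (pred1 k) = ((cows_dimers k)`_m)%R.
Proof.
elim/ltn_ind: m k => m IH k mn mN.
(* One factor [cows] is expanded. The terms in ['X] and ['X^3] match a last monomer and a last
   trimer; the remaining term, ['X^2 * cows_dimers (k - 1)] when [k > 0], matches a last dimer. *)
rewrite /cows_dimers exprS -mulrA coef_cowsM_rec // coefXM coefXnM.
rewrite mulrA -exprS -/(cows_dimers k).
case: m IH mn mN => [|m] IH mn mN.
  have -> : segment n 0 0 = set0 by apply/setP => i; rewrite !inE; lia.
  rewrite num_tilings_of_set0 /= !addr0 coefMXn.
  by case: k {IH} => [|k]; rewrite ?muln0 //= expr0 coef1.
rewrite num_tilings_segmentS // big_mkcond !big_ord_recr big_ord0 /= add0n subn0.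
have KE d : ~~ (d == 1) -> (fun j => pred1 k (j + (d == 1))) =1 pred1 k.
  by move=> /negPf -> j; rewrite addn0.
rewrite (eq_num_tilings_of _ (KE 0 isT)) (eq_num_tilings_of _ (KE 2 isT)).
rewrite !IH; try lia.
rewrite subSS ltnS.
rewrite -[RHS]/(_ + _ + _)%N.
have -> : (if 1 < m then ((cows_dimers k)`_(m - 2))%R else 0) =
          (if m < 2 then 0 else ((cows_dimers k)`_(m - 2))%R).
  by rewrite ltnNge if_neg.
congr (_ + _); rewrite [RHS]addnC; congr (_ + _).
case: k {KE} => [|k].
  (* With [k = 0] a last dimer is impossible, and the remaining term is the constant 1, with no
     coefficient of positive index. *)
  rewrite (@eq_num_tilings_of _ _ _ xpred0) => [|j]; last by rewrite addn1.
  by rewrite num_tilings_of_pred0 muln0 !expr0 mulr1 coef1; case: ifP.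
rewrite (@eq_num_tilings_of _ _ _ (pred1 k)) => [|j]; last first.
  by rewrite /= addn1 eqSS.
have -> : 2 * k.+1 = 2 * k + 2 by lia.
rewrite exprD mulrA coefMXn -/(cows_dimers k).
case: m mn mN IH => [|m] mn mN IH //=.
by rewrite !subSS subn0 IH //; lia.
Qed.

Lemma coef_cows_dimers n k :
  ((cows_dimers k)`_n)%R =
  \sum_(f : {ffun 'I_k.+1 -> 'I_N.+1} | \sum_(j < k.+1) f j + 2 * k == n)
     \prod_(j < k.+1) narayana (f j).
Proof.
rewrite /cows_dimers; have -> : (cows ^+ k.+1 =
    \prod_(j < k.+1) \sum_(i < N.+1) (narayana i *: 'X^i : {poly nat}))%R.
  by rewrite big_const_ord iter_mulr_1 /cows poly_def.
(* Distributing the product gives one monomial per choice [f] of a gap length for each factor. *)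
rewrite bigA_distr_bigA mulr_suml coef_sum [RHS]big_mkcond.
apply: eq_bigr => f _.
rewrite scaler_prod prodrXr -scalerAl -exprD coefZ coefXn eq_sym.
by case: eqP => _; rewrite ?mulr1 ?mulr0.
Qed.

End Cows.

(* The index tuple (i_0, ..., i_k) is a function f on 'I_k.+1; a sum equal to
   n - 2k forces i_j <= n, so bounding the values by n loses nothing.  The
   condition is written additively so that it is unsatisfiable when n < 2k. *)
Theorem theorem10 (n k : nat) :
  num_tilings n k =
  \sum_(f : {ffun 'I_k.+1 -> 'I_n.+1} | \sum_(j < k.+1) f j + 2 * k == n)
     \prod_(j < k.+1) narayana (f j).
Proof.
rewrite -coef_cows_dimers -(num_tilings_coef k (leqnn n)) //.
by have -> : segment n 0 n = setT by apply/setP => i; rewrite !inE ltn_ord.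
Qed.
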